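(* Let a Boolean control network $x(t+1)=Lu(t)x(t)$, $y(t)=Hx(t)$ be given, with weighted pair graph $\mathcal{G}=(\mathcal{V},\mathcal{E},\mathcal{W})$. The network is not Type-2 observable if and only if there is a non-diagonal vertex $(\delta_N^i,\delta_N^j)$ of $\mathcal{G}$ such that the deterministic finite automaton $A_{(\delta_N^i,\delta_N^j)}$ is complete.
   Context: Fix positive integers $n,m,q$ and put $N=2^n$, $M=2^m$, $Q=2^q$. For a positive integer $k$, $\delta_k^i$ is the $i$-th column of the identity matrix $I_k$ and $\Delta_k=\{\delta_k^1,\dots,\delta_k^k\}$. A logical matrix of size $k\times s$ is one all of whose columns lie in $\Delta_k$. A Boolean control network (BCN, in algebraic form) is a system $x(t+1)=Lu(t)x(t)$, $y(t)=Hx(t)$, $t=0,1,2,\dots$, with states $x(t)\in\Delta_N$, inputs $u(t)\in\Delta_M$, outputs $y(t)\in\Delta_Q$, where $L$ is an $N\times NM$ logical matrix and $H$ is a $Q\times N$ logical matrix. Products are semi-tensor products; concretely $Lux=L(u\otimes x)$ for $u\in\Delta_M$, $x\in\Delta_N$, with $\otimes$ the Kronecker product. For $x_0\in\Delta_N$, $p\ge 1$ and $U=u_0\cdots u_{p-1}\in(\Delta_M)^p$, put $x_{t+1}=Lu_tx_t$ for $0\le t<p$ and $(HL)_{x_0}^p(U)=(Hx_1)\cdots(Hx_p)\in(\Delta_Q)^p$. Type-2 observability: for any distinct $x_0,\bar x_0\in\Delta_N$ there exist $p\ge1$ and $U\in(\Delta_M)^p$ such that $Hx_0=H\bar x_0$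 implies $(HL)_{x_0}^p(U)\neq(HL)_{\bar x_0}^p(U)$. Weighted pair graph $\mathcal{G}=(\mathcal{V},\mathcal{E},\mathcal{W})$: $\mathcal{V}$ is the set of unordered pairs $(x,x')$ (so $(x,x')=(x',x)$, and $x=x'$ is allowed) of elements of $\Delta_N$ with $Hx=Hx'$. For vertices $v=(x_1,x_1')$, $w=(x_2,x_2')$, let $\mathcal{W}((v,w))$ be the set of $u\in\Delta_M$ such that ($Lux_1=x_2$ and $Lux_1'=x_2'$) or ($Lux_1=x_2'$ and $Lux_1'=x_2$). The directed edge $(v,w)$ belongs to $\mathcal{E}$ iff this set is nonempty, and then it is the weight of the edge. A vertex $(x,x)$ is called diagonal; the other vertices are non-diagonal. A deterministic finite automaton (DFA) is $A=(S,\Sigma,\sigma,s_0,F)$ with finite state set $S$, finite nonempty alphabet $\Sigma$, initial state $s_0\in S$, final states $F\subset S$, and a partial transition function $\sigma:S\times\Sigma\to S$. It is complete if $\sigma$ is a total function (defined at every pair $(s,a)\in S\times\Sigma$, equivalently its natural extension to $S\times\Sigma^*$ is total). The DFA $A_{(\delta_N^i,\delta_N^j)}$, for a non-diagonal vertex $(\delta_N^i,\delta_N^j)$: its alphabet is $\Delta_M$; its initial state is the vertex $(\delta_N^i,\delta_N^j)$; its states are this vertex together with all vertices $v\in\mathcal{V}$ reachable from it by a directed path in $\mathcal{G}$; its transition graph is the subgraph of $\mathcal{G}$ induced on these vertices, i.e. the transition function at $(v,u)$ has value $w$ iff $(v,w)\in\mathcal{E}$ and $u\in\mathcal{W}((v,w))$,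 and is undefined at $(v,u)$ if no such $w$ exists. All states are final. *)

(* Defs.v *)
From mathcomp Require Import all_boot all_order all_algebra.
From mathcomp Require Import mxtens.

Set Implicit Arguments.
Unset Strict Implicit.
Unset Printing Implicit Defensive.

Import GRing.Theory.
Local Open Scope ring_scope.

(** ** Logical vectors and logical matrices *)

Definition delta (k : nat) (i : 'I_k) : 'cV[int]_k := col i 1%:M.

(* [seq_sub] makes this a finite subtype of 'cV[int]_k; [ssval] returns the
   vector. *)
Definition Delta (k : nat) : finType := seq_sub (codom (@delta k)).

Definition logical (k s : nat) (A : 'M[int]_(k, s)) : bool :=
  [forall j, col j A \in codom (@delta k)].

Lemma deltaE k (i : 'I_k) : delta i = delta_mx i 0.
Proof. by apply/matrixP=> a b; rewrite !mxE ord1 eqxx andbT. Qed.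

Lemma delta_inj k : injective (@delta k).
Proof.
move=> i j /matrixP/(_ i 0) /eqP; rewrite !mxE eqxx.
by case: (i =P j).
Qed.

Lemma card_Delta k : #|Delta k| = k.
Proof.
by rewrite card_seq_sub ?size_codom ?card_ord // map_inj_uniq ?enum_uniq //;
   exact: delta_inj.
Qed.

Lemma logical_mul k s (A : 'M[int]_(k, s)) (v : 'cV[int]_s) :
  logical A -> v \in codom (@delta s) -> A *m v \in codom (@delta k).
Proof.
by move=> /forallP logA /codomP[j ->]; rewrite deltaE -colE; apply: logA.
Qed.

Lemma tens_delta k s (u : 'cV[int]_k) (x : 'cV[int]_s) :
  u \in codom (@delta k) -> x \in codom (@delta s) ->
  (u *t x : 'cV[int]_(k * s)) \in codom (@delta (k * s)).
Proof.
move=> /codomP[i ->] /codomP[j ->]; apply/codomP; exists (mxtens_index (i, j)).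
rewrite !deltaE; apply/matrixP=> a b; case: (mxtens_indexP a)=> a1 a2.
rewrite !mxE mxtens_indexK !ord1 /= !eqxx !andbT.
by rewrite (can_eq (@mxtens_indexK _ _)) xpair_eqE mulr_natl mulrb; case: eqP.
Qed.

(** ** Boolean control networks *)

Record bcn (n m q : nat) := Bcn {
  bcn_L : 'M[int]_(2 ^ n, 2 ^ m * 2 ^ n);
  bcn_H : 'M[int]_(2 ^ q, 2 ^ n);
  bcn_L_logical : logical bcn_L;
  bcn_H_logical : logical bcn_H
}.

Section Network.

Variables (n m q : nat) (B : bcn n m q).

Local Notation N := (2 ^ n)%N.
Local Notation M := (2 ^ m)%N.
Local Notation Q := (2 ^ q)%N.

Lemma step_subproof (u : Delta M) (x : Delta N) :
  bcn_L B *m (ssval u *t ssval x) \in codom (@delta N).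
Proof.
exact: logical_mul (bcn_L_logical B) (tens_delta (ssvalP u) (ssvalP x)).
Qed.

Definition step (u : Delta M) (x : Delta N) : Delta N :=
  SeqSub (step_subproof u x).

Lemma output_subproof (x : Delta N) :
  bcn_H B *m ssval x \in codom (@delta Q).
Proof. exact: logical_mul (bcn_H_logical B) (ssvalP x). Qed.

Definition output (x : Delta N) : Delta Q := SeqSub (output_subproof x).

(* [scanl] lists the states x_1, ..., x_p and leaves out x_0. *)
Definition HL (p : nat) (x0 : Delta N) (U : p.-tuple (Delta M)) :
    p.-tuple (Delta Q) :=
  [tuple of map output (scanl (fun x u => step u x) x0 U)].

Definition type2_observable : Prop :=
  forall x0 x0' : Delta N, x0 <> x0' ->
  exists p : nat, (1 <= p)%N /\
  exists U : p.-tuple (Delta M),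
    output x0 = output x0' -> HL x0 U <> HL x0' U.

(** ** The weighted pair graph *)

(* The unordered pair (x, x') is the set [set x; x'], a singleton if x = x'. *)
Definition is_vertex (A : {set Delta N}) : bool :=
  [exists x, exists x', (A == [set x; x']) && (output x == output x')].

Definition vertex : finType := {A : {set Delta N} | is_vertex A}.

Definition diagonal (v : vertex) : bool := [exists x, val v == [set x; x]].

Definition weight (v w : vertex) : {set Delta M} :=
  [set u | [exists x1, exists x1', exists x2, exists x2',
    [&& val v == [set x1; x1'], val w == [set x2; x2'] &
        ((step u x1 == x2) && (step u x1' == x2'))
     || ((step u x1 == x2') && (step u x1' == x2))]]].

Definition edge : rel vertex := fun v w => weight v w != set0.

End Network.

(** ** Deterministic finite automata *)

Record dfa := Dfa {
  dfa_state : finType;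
  dfa_alphabet : finType;
  dfa_alphabet_gt0 : (0 < #|dfa_alphabet|)%N;
  dfa_trans : dfa_state -> dfa_alphabet -> option dfa_state;
  dfa_start : dfa_state;
  dfa_final : {set dfa_state}
}.

Definition dfa_complete (A : dfa) : Prop :=
  forall (s : dfa_state A) (a : dfa_alphabet A), dfa_trans s a.

Section PairAutomaton.

Variables (n m q : nat) (B : bcn n m q) (v0 : vertex B).

(* [connect] is reflexive, so v0 itself is a state. *)
Definition pair_state : finType := {v : vertex B | connect (@edge _ _ _ B) v0 v}.

Definition pair_start : pair_state := exist _ v0 (connect0 _ v0).

(* At most one w qualifies, see [pair_transP]. *)
Definition pair_trans (s : pair_state) (u : Delta (2 ^ m)) :
    option pair_state :=
  [pick w : pair_state | edge (val s) (val w) && (u \in weight (val s) (val w))].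

Lemma weightE (v w : vertex B) u :
  (u \in weight v w) = (val w == step B u @: val v).
Proof.
rewrite inE; apply/idP/eqP.
  case/existsP=> x1 /existsP[x1' /existsP[x2 /existsP[x2']]].
  case/and3P=> /eqP-> /eqP-> /orP[] /andP[/eqP<- /eqP<-].
    by rewrite imsetU1 imset_set1.
  by rewrite imsetU1 imset_set1 setUC.
move=> ->; case/existsP: (valP v)=> x /existsP[x' /andP[/eqP-> _]].
apply/existsP; exists x; apply/existsP; exists x'.
apply/existsP; exists (step B u x); apply/existsP; exists (step B u x').
by rewrite imsetU1 imset_set1 !eqxx.
Qed.

Lemma pair_transP (s w : pair_state) u :
  pair_trans s u = Some w <->
  edge (val s) (val w) /\ u \in weight (val s) (val w).
Proof.
rewrite /pair_trans; case: pickP=> [w' /andP[e' u']|none]; split=> //.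
- by case=> <-.
- case=> _; move: u'; rewrite !weightE=> /eqP u' /eqP uw.
  by congr Some; do 2!apply: val_inj; rewrite u' uw.
- by case=> e uw; move: (none w); rewrite e uw.
Qed.

Lemma inputs_gt0 : (0 < #|Delta (2 ^ m)|)%N.
Proof. by rewrite card_Delta expn_gt0. Qed.

Definition pair_dfa : dfa :=
  {| dfa_state := pair_state;
     dfa_alphabet := Delta (2 ^ m);
     dfa_alphabet_gt0 := inputs_gt0;
     dfa_trans := pair_trans;
     dfa_start := pair_start;
     dfa_final := [set: pair_state] |}.

End PairAutomaton.

(* Main.v *)
Require Import Defs.
From mathcomp Require Import all_boot.

(** A transition of the pair automaton from {x, x'} under the input u can only
    lead to {L u x, L u x'}, so it exists if and only if these two states have
    the same output ([pair_trans_isSome], [is_vertex_pair]).  Hence: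

    - If the automaton of {x, x'} is complete, then every input word can be
      read from {x, x'} and the outputs agree all along the word, so that no
      word distinguishes x from x' ([complete_outputs]).  When x <> x' this
      contradicts observability.

    - If the automaton of {x, x'} is not complete, some pair reachable from
      {x, x'} lacks a transition.  Reading off the inputs along a path to that
      pair, followed by the input without transition, gives a nonempty word
      whose last outputs differ ([stuck_outputs]).  If this happens for all
      x <> x' with the same output, the network is observable.

    All quantifiers of completeness range over finite types, so it is
    decidable whether some non-diagonal pair has a complete automaton, and the
    equivalence follows from these two facts without classical axioms. *)

Set Implicit Arguments.
Unset Strict Implicit.
Unset Printing Implicit Defensive.

Section PairObservability.

Variables (n m q : nat) (B : bcn n m q).

Implicit Types (x : Delta (2 ^ n)) (u : Delta (2 ^ m)) (v w : vertex B).

(** The sequence underlying [HL]: it is free of the length index, which makes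
    induction on words possible. *)
Definition outputs x (U : seq (Delta (2 ^ m))) : seq (Delta (2 ^ q)) :=
  map (output B) (scanl (fun y u => step B u y) x U).

Lemma HL_eq p x x' (U : p.-tuple (Delta (2 ^ m))) :
  (HL B x U == HL B x' U) = (outputs x U == outputs x' U).
Proof. by []. Qed.

Lemma step_pair u x x' :
  step B u @: [set x; x'] = [set step B u x; step B u x'].
Proof. by rewrite imsetU1 imset_set1. Qed.

(** An unordered pair may be written in two ways, but the condition on the
    outputs is symmetric. *)
Lemma is_vertex_pair x x' :
  is_vertex B [set x; x'] = (output B x == output B x').
Proof.
apply/existsP/idP => [[y /existsP[y' /andP[/eqP eq_xy /eqP eq_out]]]|eq_out].
  have out_y z : z \in [set x; x'] -> output B z = output B y.
    by rewrite eq_xy => /set2P[] ->.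
  by rewrite !out_y ?set21 ?set22.
by exists x; apply/existsP; exists x'; rewrite eqxx.
Qed.

Lemma diagonal_pair v x x' : val v = [set x; x'] -> diagonal v = (x == x').
Proof.
move=> eq_v; apply/existsP/eqP => [[y]|eq_x]; last by exists x; rewrite eq_v -eq_x.
rewrite eq_v setUid => /eqP eq_y.
have all_y z : z \in [set x; x'] -> z = y by rewrite eq_y => /set1P.
by rewrite [x]all_y ?set21 // [x']all_y ?set22.
Qed.

Lemma pair_trans_isSome v (s : pair_state v) u :
  isSome (pair_trans s u) = is_vertex B (step B u @: val (val s)).
Proof.
apply/idP/idP => [|vtx].
  case eq_t: (pair_trans s u) => [w|] // _.
  by case/pair_transP: eq_t => _; rewrite weightE => /eqP <-; apply: valP.
pose w : vertex B := Sub _ vtx.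
have u_w : u \in weight (val s) w by rewrite weightE.
have edge_w : edge (val s) w by apply/set0Pn; exists u.
have reach_w : connect (@edge _ _ _ B) v w.
  exact: connect_trans (valP s) (connect1 edge_w).
suff -> : pair_trans s u = Some (Sub w reach_w) by [].
by apply/pair_transP.
Qed.

Lemma complete_outputs v (s : pair_state v) x x' U :
  dfa_complete (pair_dfa v) -> val (val s) = [set x; x'] ->
  outputs x U = outputs x' U.
Proof.
move=> complete_v; elim: U s x x' => [|u U IHU] s x x' eq_s //=.
have : isSome (pair_trans s u) by apply: complete_v.
case eq_t: (pair_trans s u) => [w|] // _.
have eq_w : val (val w) = [set step B u x; step B u x'].
  by case/pair_transP: eq_t => _; rewrite weightE eq_s step_pair => /eqP.
have /eqP eq_out : output B (step B u x) == output B (step B u x').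
  by rewrite -is_vertex_pair -eq_w; apply: valP.
by rewrite /outputs /= eq_out; congr (_ :: _); apply: IHU eq_w.
Qed.

(** The induction goes back along the path: each edge prepends one of its
    inputs to the distinguishing word. *)
Lemma stuck_outputs v w u x x' :
  connect (@edge _ _ _ B) v w -> ~~ is_vertex B (step B u @: val w) ->
  val v = [set x; x'] ->
  exists U, 0 < size U /\ outputs x U != outputs x' U.
Proof.
case/connectP=> p; elim: p v x x' => [|v1 p IHp] v x x'.
  move=> _ -> stuck eq_v; exists [:: u]; split=> //.
  by move: stuck; rewrite eq_v step_pair is_vertex_pair eqseq_cons andbT.
rewrite [path _ _ _]/= => /andP[/set0Pn[u1]]; rewrite weightE => /eqP eq_v1.
move=> path_p last_p stuck eq_v.
rewrite eq_v step_pair in eq_v1.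
have [U [_ neq_U]] := IHp _ _ _ path_p last_p stuck eq_v1.
exists (u1 :: U); split=> //.
by rewrite /outputs /= eqseq_cons negb_and neq_U orbT.
Qed.

Lemma dfa_completeP v :
  reflect (dfa_complete (pair_dfa v))
    [forall s : pair_state v, forall u, isSome (pair_trans s u)].
Proof.
apply: (iffP forallP) => [all_s s u|complete_v s].
  exact: forallP (all_s s) u.
by apply/forallP => u; apply: complete_v.
Qed.

Lemma incomplete_observable :
  (forall v, ~~ diagonal v -> ~ dfa_complete (pair_dfa v)) ->
  type2_observable B.
Proof.
move=> incomplete x x' neq_x.
have [eq_out|neq_out] := eqVneq (output B x) (output B x'); last first.
  (* The conclusion is vacuous, but a nonempty word has to be supplied. *)
  have /card_gt0P[u _] := inputs_gt0 m.
  exists 1; split=> //; exists [tuple u] => eq_out.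
  by rewrite eq_out eqxx in neq_out.
have vtx : is_vertex B [set x; x'] by rewrite is_vertex_pair eq_out.
pose v : vertex B := Sub _ vtx.
have ndiag_v : ~~ diagonal v by rewrite (@diagonal_pair v x x') //; apply/eqP.
have /dfa_completeP := incomplete v ndiag_v.
rewrite negb_forall => /existsP[s]; rewrite negb_forall => /existsP[u].
rewrite pair_trans_isSome => stuck.
have [U [U_gt0 neq_U]] := stuck_outputs (valP s) stuck (erefl : val v = _).
exists (size U); split=> //; exists (in_tuple U) => _ /eqP.
by rewrite HL_eq (negPf neq_U).
Qed.

Lemma complete_not_observable v :
  ~~ diagonal v -> dfa_complete (pair_dfa v) -> ~ type2_observable B.
Proof.
move=> ndiag_v complete_v observable.
have /existsP[x /existsP[x' /andP[/eqP eq_v /eqP eq_out]]] := valP v.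
move: ndiag_v; rewrite (diagonal_pair eq_v) => /eqP neq_x.
have [p [_ [U neq_HL]]] := observable x x' neq_x.
case: (neq_HL eq_out); apply/eqP; rewrite HL_eq; apply/eqP.
exact: (@complete_outputs v (pair_start v)).
Qed.

End PairObservability.

Theorem mainTheorem4 (n m q : nat) (n_gt0 : 0 < n) (m_gt0 : 0 < m) (q_gt0 : 0 < q)
    (B : bcn n m q) :
  ~ type2_observable B <->
  exists v : vertex B, ~~ diagonal v /\ dfa_complete (pair_dfa v).
Proof.
split=> [not_obs|[v [ndiag_v complete_v]]]; last first.
  exact: complete_not_observable ndiag_v complete_v.
have [/existsP[v /andP[ndiag_v /dfa_completeP complete_v]]|none] :=
  boolP [exists v : vertex B, ~~ diagonal v &&
           [forall s : pair_state v, forall u, isSome (pair_trans s u)]].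
  by exists v.
case: not_obs; apply: incomplete_observable => v ndiag_v /dfa_completeP complete_v.
by case/existsP: none; exists v; rewrite ndiag_v.
Qed.
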